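(* Consider the full propagation setting. The expected number of adopters can be computed in polynomial time for a given non-adaptive spreading strategy $\pi$.
   Context: Full propagation setting. There are $n$ areas; area $v$ has a threshold $c_v\in\mathbb{Z}_{>0}$ and an initial acceptance probability $p_v\in[0,1]$, all of which are given. A non-adaptive spreading strategy is a permutation $\pi$ of the areas fixed in advance; $\pi(t)$ is the area scheduled at time $t$. When $v=\pi(t)$ is scheduled it makes an irrevocable decision $X_v\in\{1,-1\}$ ($1$ = accept, $-1$ = reject): with $I_{t-1}=\sum_{s<t}X_{\pi(s)}$, if $I_{t-1}\ge c_v$ then $X_v=1$; if $I_{t-1}\le -c_v$ then $X_v=-1$; if $|I_{t-1}|<c_v$ then, independently of the past, $X_v=1$ with probability $p_v$ and $X_v=-1$ with probability $1-p_v$. The number of adopters is the number of areas $v$ with $X_v=1$. *)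

(* Defs.v *)
From HB Require Import structures.
From mathcomp Require Import all_boot all_order all_fingroup all_algebra.

Set Implicit Arguments.
Unset Strict Implicit.
Unset Printing Implicit Defensive.

Import Order.TTheory GRing.Theory Num.Theory.
Local Open Scope ring_scope.

(** * Random access machines with logarithmic cost

    The machine is the one of Cook and Reckhow (1973) and of Aho, Hopcroft and
    Ullman (1974): finitely many instructions, an unbounded memory whose cells
    hold arbitrarily large natural numbers, a read-only input tape and a
    write-only output tape of natural numbers.  Every instruction is charged the
    bit lengths of all the addresses and values that it handles; with this cost,
    and unlike with unit cost, polynomial time coincides with polynomial time on
    Turing machines. *)

Inductive instr : Type :=
  | Const of nat & nat          (* X_i := k *)
  | Add of nat & nat & nat      (* X_i := X_j + X_k *)
  | Sub of nat & nat & nat      (* X_i := X_j - X_k, truncated at 0 *)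
  | Mul of nat & nat & nat      (* X_i := X_j * X_k *)
  | Fetch of nat & nat           (* X_i := X_(X_j) *)
  | Store of nat & nat          (* X_(X_i) := X_j *)
  | JumpPos of nat & nat        (* if X_i > 0 then continue at instruction l *)
  | Read of nat                 (* X_i := next number on the input tape *)
  | Write of nat                (* append X_i to the output tape *)
  | Halt.

Definition program := seq instr.

Record state := State {
  pc : nat;
  mem : nat -> nat;
  input : seq nat;
  output : seq nat
}.

Definition upd (m : nat -> nat) (i x : nat) : nat -> nat :=
  fun j => if j == i then x else m j.

(* Number of binary digits; the bit length of 0 is 1. *)
Definition bitlen (x : nat) : nat := (trunc_log 2 x).+1.

(* [None] when the instruction is [Halt] or when the input is exhausted. *)
Definition exec_instr (a : instr) (s : state) : option state :=
  let: State l m u o := s in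
  match a with
  | Const i k => Some (State l.+1 (upd m i k) u o)
  | Add i j k => Some (State l.+1 (upd m i (m j + m k)%N) u o)
  | Sub i j k => Some (State l.+1 (upd m i (m j - m k)%N) u o)
  | Mul i j k => Some (State l.+1 (upd m i (m j * m k)%N) u o)
  | Fetch i j => Some (State l.+1 (upd m i (m (m j))) u o)
  | Store i j => Some (State l.+1 (upd m (m i) (m j)) u o)
  | JumpPos i l' => Some (State (if (0 < m i)%N then l' else l.+1) m u o)
  | Read i => if u is x :: u' then Some (State l.+1 (upd m i x) u' o) else None
  | Write i => Some (State l.+1 m u (rcons o (m i)))
  | Halt => None
  end.

Definition cost (a : instr) (s : state) : nat :=
  let m := mem s in
  match a with
  | Const i k => bitlen i + bitlen k
  | Add i j k | Sub i j k | Mul i j k =>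
      bitlen i + bitlen j + bitlen (m j) + bitlen k + bitlen (m k)
  | Fetch i j => bitlen i + bitlen j + bitlen (m j) + bitlen (m (m j))
  | Store i j => bitlen i + bitlen (m i) + bitlen j + bitlen (m j)
  | JumpPos i l => bitlen i + bitlen (m i) + bitlen l
  | Read i => bitlen i + bitlen (head 0 (input s))
  | Write i => bitlen i + bitlen (m i)
  | Halt => 1
  end%N.

(* [halts P s o t]: started in state [s], the program reaches a [Halt]
   instruction with output tape [o], at total cost [t].  Running past the end
   of the program or of the input is a failure. *)
Inductive halts (P : program) : state -> seq nat -> nat -> Prop :=
  | HaltsNow s :
      onth P (pc s) = Some Halt -> halts P s (output s) (cost Halt s)
  | HaltsStep s a s' o t :
      onth P (pc s) = Some a -> exec_instr a s = Some s' ->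
      halts P s' o t -> halts P s o (cost a s + t)%N.

Definition initial (u : seq nat) : state := State 0 (fun=> 0%N) u [::].

Definition bitsize (u : seq nat) : nat := \sum_(x <- u) bitlen x.

Definition poly_time_computable (A B : Type) (code : A -> seq nat)
    (represents : seq nat -> B -> Prop) (f : A -> B) : Prop :=
  exists (P : program) (T : {poly nat}), forall a : A,
  exists (o : seq nat) (t : nat),
    [/\ halts P (initial (code a)) o t,
        represents o (f a)
      & (t <= T.[bitsize (code a)])%N].

(** * Full propagation *)

(* Times run over 0, ..., n - 1, and [strategy t] is the area scheduled at time
   [t].  The probabilities are rational so that an instance is a finite
   object. *)
Record instance := Instance {
  areas : nat;
  threshold : 'I_areas -> nat;
  threshold_gt0 : forall v, (0 < threshold v)%N;
  prob : 'I_areas -> rat;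
  prob_01 : forall v, 0 <= prob v <= 1;
  strategy : 'S_areas
}.

Section Process.
Variable a : instance.
Local Notation n := (areas a).
Local Notation pi := (strategy a).

(* An outcome assigns to each area its decision; [true] stands for X_v = 1 and
   [false] for X_v = -1. *)
Definition outcome := {ffun 'I_n -> bool}.

Definition decision (x : outcome) (v : 'I_n) : int := if x v then 1 else -1.

(* I_(t-1): the sum of the decisions taken strictly before time t. *)
Definition influence (x : outcome) (t : 'I_n) : int :=
  \sum_(s < n | (s < t)%N) decision x (pi s).

(* Conditional probability that v accepts, given the sum i of past decisions. *)
Definition accept_prob (v : 'I_n) (i : int) : rat :=
  if (threshold v)%:Z <= i then 1
  else if i <= - (threshold v)%:Z then 0
  else prob v.

Definition decision_prob (v : 'I_n) (i : int) (b : bool) : rat :=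
  if b then accept_prob v i else 1 - accept_prob v i.

(* The law of the process, by the chain rule along the schedule. *)
Definition outcome_prob (x : outcome) : rat :=
  \prod_(t < n) decision_prob (pi t) (influence x t) (x (pi t)).

Definition adopters (x : outcome) : nat := #|[set v | decision x v == 1]|.

Definition expected_adopters : rat :=
  \sum_(x : outcome) outcome_prob x * (adopters x)%:R.

(* n, then c_v and the numerator and denominator of p_v for each area v in
   order, then the schedule; all numbers count with their binary length. *)
Definition instance_code : seq nat :=
  n :: flatten [seq [:: threshold v; `|numq (prob v)|%N; `|denq (prob v)|%N]
               | v <- enum 'I_n]
    ++ [seq val (pi t) | t <- enum 'I_n].

End Process.

(* A fraction, not necessarily in lowest terms. *)
Definition fraction_code (o : seq nat) (q : rat) : Prop :=
  exists a b : nat, [/\ o = [:: a; b], (0 < b)%N & q = a%:R / b%:R].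

(* Main.v *)
Require Import Defs.
From HB Require Import structures.
From mathcomp Require Import all_boot all_order all_fingroup all_algebra.
From mathcomp Require Import zify ring.

Set Implicit Arguments.
Unset Strict Implicit.
Unset Printing Implicit Defensive.

(** The future of the process depends on the past only through the number k of
    acceptances among the first t areas, since the influence is 2k - t.  Let
    [D t] be the product of the denominators of the first t acceptance
    probabilities.  Then [D t] times the probability of k acceptances is a
    natural number [weight t k <= D t], and the weights obey a two-term
    recurrence in t.  A machine can therefore tabulate them in place, with O(n^2)
    instructions on numbers whose bit length is linear in that of the input, and
    the expected number of adopters is the sum of the [k * weight n k] divided by
    [D n]. *)

(** * Execution of programs with bounded values *)

Lemma bitlen_le (L x : nat) : 0 < L -> x < 2 ^ L -> bitlen x <= L.
Proof.
rewrite /bitlen => L0 xL; case: (posnP x) => [->|x0]; first by rewrite trunc_log0.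
by rewrite -(ltn_exp2l _ _ (ltnSn 1)); apply: leq_ltn_trans (trunc_logP _ _) xL.
Qed.

Lemma bitlen_ltn (x : nat) : x < 2 ^ bitlen x.
Proof. exact: trunc_log_ltn. Qed.

(** The instructions whose whole effect is one memory update and a move to the next address;
    [target] and [value] describe the update. *)
Definition straight (a : instr) : bool :=
  match a with
  | Const _ _ | Add _ _ _ | Defs.Sub _ _ _ | Mul _ _ _ | Fetch _ _ | Store _ _ => true
  | _ => false
  end.

Definition target (a : instr) (m : nat -> nat) : nat :=
  match a with
  | Const i _ | Add i _ _ | Defs.Sub i _ _ | Mul i _ _ | Fetch i _ => i
  | Store i _ => m i
  | _ => 0
  end.

Definition value (a : instr) (m : nat -> nat) : nat :=
  match a with
  | Const _ k => k
  | Add _ j k => m j + m k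
  | Defs.Sub _ j k => m j - m k
  | Mul _ j k => m j * m k
  | Fetch _ j => m (m j)
  | Store _ j => m j
  | _ => 0
  end.

Definition constants (a : instr) : seq nat :=
  match a with
  | Const i k => [:: i; k]
  | Add i j k | Defs.Sub i j k | Mul i j k => [:: i; j; k]
  | Fetch i j | Store i j | JumpPos i j => [:: i; j]
  | Read i | Write i => [:: i]
  | Halt => [::]
  end.

(* Convertible to [upd], but reducible by unfolding a few constants. *)
Definition updn (m : nat -> nat) (i x : nat) : nat -> nat :=
  fun j => if eqn j i then x else m j.

Fixpoint run_block (b : seq instr) (m : nat -> nat) : nat -> nat :=
  if b is a :: b' then run_block b' (updn m (target a m) (value a m)) else m.

Fixpoint block_values (b : seq instr) (m : nat -> nat) : seq nat :=
  if b is a :: b' then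
    value a m :: block_values b' (updn m (target a m) (value a m))
  else [::].

Lemma take_drop_cons (T : Type) (x : T) (s1 s2 : seq T) (l : nat) :
  take (size s1).+1 (drop l s2) = x :: s1 ->
  onth s2 l = Some x /\ take (size s1) (drop l.+1 s2) = s1.
Proof.
elim: s2 l => [|y s2 IH] [|l] //=; last exact: IH.
by case=> ->; rewrite drop0.
Qed.

Section Execution.
Variables (P : program) (L : nat).
Local Notation M := (2 ^ L).

(** N is only an upper bound on the number of steps, since [ReachesRefl] allows any N. The factor 5
    is the largest number of bit lengths charged to one instruction. *)
Inductive reaches : nat -> state -> state -> Prop :=
  | ReachesRefl N s : reaches N s s
  | ReachesStep N s a s' s'' :
      onth P (pc s) = Some a -> exec_instr a s = Some s' ->
      cost a s <= 5 * L -> reaches N s' s'' -> reaches N.+1 s s''.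

Lemma reaches_trans N1 N2 s1 s2 s3 :
  reaches N1 s1 s2 -> reaches N2 s2 s3 -> reaches (N1 + N2) s1 s3.
Proof.
elim=> [N s|N s a s' s'' Ps Es Cs _ IH] H; last first.
  by rewrite addSn; apply: ReachesStep Ps Es Cs (IH H).
elim: H => [K s'|K s' a u v Ps Es Cs _ IH]; first exact: ReachesRefl.
by rewrite addnS; apply: ReachesStep Ps Es Cs IH.
Qed.

Lemma reaches_weaken N1 N2 s1 s2 :
  N1 <= N2 -> reaches N1 s1 s2 -> reaches N2 s1 s2.
Proof.
move=> leN H; rewrite -(subnKC leN).
by apply: reaches_trans H (ReachesRefl _ _).
Qed.

Lemma halts_reaches N s s' :
  0 < L -> onth P (pc s') = Some Halt -> reaches N s s' ->
  exists2 t, halts P s (output s') t & t <= N.+1 * (5 * L).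
Proof.
move=> L0 Ph H; elim: H Ph => {s s'} [K s|K s a s' s'' Ps Es Cs _ IH] Ph.
  by exists (cost Halt s); [apply: HaltsNow | rewrite /=; lia].
have [t Ht tle] := IH Ph; exists (cost a s + t); first exact: HaltsStep Es Ht.
lia.
Qed.

Definition bounded_mem (m : nat -> nat) := forall i, m i < M.

Lemma bounded_upd m i x : bounded_mem m -> x < M -> bounded_mem (upd m i x).
Proof. by move=> Hm Hx j; rewrite /upd; case: eqP. Qed.

Hypothesis L_gt0 : 0 < L.
Hypothesis P_const : all (fun a => all (fun k => k < M) (constants a)) P.

Lemma constants_lt l a : onth P l = Some a -> all (fun k => k < M) (constants a).
Proof.
move=> Pl; have lP : l < size P by rewrite -onthTE Pl.
by rewrite -(onth_nth Halt _ _ _ Pl); move/all_nthP: P_const; apply.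
Qed.

Lemma cost_le l a m u o :
  onth P l = Some a -> bounded_mem m -> all (fun x => x < M) u ->
  cost a (State l m u o) <= 5 * L.
Proof.
move=> /constants_lt Ca Hm Hu.
have B x : x < M -> bitlen x <= L by apply: bitlen_le.
have Bm i : bitlen (m i) <= L by exact/B/Hm.
have Bu : bitlen (head 0 u) <= L.
  by apply: B; case: u Hu => [|x u] /=; [rewrite expn_gt0 | case/andP].
case: a Ca => /= [i k|i j k|i j k|i j k|i j|i j|i j|i|i|] /=;
  rewrite ?andbT; try (case/and3P=> /B Hi /B Hj /B Hk);
  try (case/andP=> /B Hi /B Hj); try (move=> /B Hi);
  repeat match goal with
  | |- context [bitlen (m ?x)] => move: (bitlen (m x)) (Bm x) => ? ?
  end; lia.
Qed.

(** For a concrete program the hypothesis on [take] and [drop] holds by computation; the work lies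
    in bounding the values that the block writes. *)
Lemma reaches_block l b m u o :
  take (size b) (drop l P) = b ->
  all straight b -> bounded_mem m -> all (fun x => x < M) u ->
  all (fun x => x < M) (block_values b m) ->
  reaches (size b) (State l m u o) (State (l + size b) (run_block b m) u o) /\
  bounded_mem (run_block b m).
Proof.
elim: b l m => [|a b IH] l m Pb /=.
  by move=> _ Hm _ _; rewrite addn0; split=> //; apply: ReachesRefl.
move=> /andP[sa sb] Hm Hu /andP[va vb].
have [Pl Pb'] := take_drop_cons Pb.
have [R B] := IH l.+1 _ Pb' sb (bounded_upd (target a m) Hm va) Hu vb.
split=> //.
rewrite addSnnS in R; apply: (@ReachesStep _ (State l m u o) a _ _ Pl _
  (cost_le _ Pl Hm Hu) R).
by case: a sa {va vb B R Pb Pb' Pl}.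
Qed.

Lemma reaches_jump l r l' m u o :
  onth P l = Some (JumpPos r l') -> bounded_mem m -> all (fun x => x < M) u ->
  reaches 1 (State l m u o) (State (if 0 < m r then l' else l.+1) m u o).
Proof.
move=> Pl Hm Hu.
exact: (@ReachesStep 0 (State l m u o) _ _ _ Pl _ (cost_le _ Pl Hm Hu)
  (ReachesRefl _ _)).
Qed.

Lemma reaches_read l i x m u o :
  onth P l = Some (Read i) -> bounded_mem m -> all (fun x => x < M) (x :: u) ->
  reaches 1 (State l m (x :: u) o) (State l.+1 (upd m i x) u o) /\
  bounded_mem (upd m i x).
Proof.
move=> Pl Hm Hu; split; last by apply: bounded_upd; case/andP: Hu.
exact: (@ReachesStep 0 (State l m (x :: u) o) _ _ _ Pl _ (cost_le _ Pl Hm Hu)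
  (ReachesRefl _ _)).
Qed.

Lemma reaches_write l i m u o :
  onth P l = Some (Write i) -> bounded_mem m -> all (fun x => x < M) u ->
  reaches 1 (State l m u o) (State l.+1 m u (rcons o (m i))).
Proof.
move=> Pl Hm Hu.
exact: (@ReachesStep 0 (State l m u o) _ _ _ Pl _ (cost_le _ Pl Hm Hu)
  (ReachesRefl _ _)).
Qed.

(** The test stands at l, after the body, and the loop is entered there. Each round costs N steps
    and one successful test; the failing test adds the last step. *)
Lemma reaches_loop l r l' N o (Inv : nat -> (nat -> nat) -> seq nat -> Prop) :
  onth P l = Some (JumpPos r l') ->
  (forall j m u, Inv j m u ->
     [/\ m r = j, bounded_mem m & all (fun x => x < M) u]) ->
  (forall j m u, Inv j.+1 m u -> exists m' u',
     reaches N (State l' m u o) (State l m' u' o) /\ Inv j m' u') ->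
  forall j m u, Inv j m u -> exists m' u',
    reaches (j * N.+1).+1 (State l m u o) (State l.+1 m' u' o) /\ Inv 0 m' u'.
Proof.
move=> Pl InvE body; elim=> [|j IH] m u Im; have [mr Hm Hu] := InvE _ _ _ Im;
  have := reaches_jump o Pl Hm Hu; rewrite mr /= => R.
  by exists m, u.
have [m1 [u1 [R1 /IH[m2 [u2 [R2 I2]]]]]] := body _ _ _ Im.
exists m2, u2; split=> //.
apply: reaches_weaken (reaches_trans R (reaches_trans R1 R2)); lia.
Qed.

End Execution.

(** Comparisons of literal addresses compute away; those with a symbolic address are folded back
    into [eqn]. *)
Ltac eval_block :=
  cbv beta iota delta [run_block block_values target value updn eqn size all]; fold eqn.

(** * The program *)

Section Weights.
Variables c a d : nat -> nat.

(** This is [d t] times the acceptance probability at influence 2k - t; the threshold tests are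
    rearranged to avoid negative numbers. *)
Definition gain (t k : nat) : nat :=
  if t + c t <= 2 * k then d t else if 2 * k + c t <= t then 0 else a t.

Fixpoint weight (t k : nat) : nat :=
  if t is t'.+1 then
    (d t' - gain t' k) * weight t' k +
    (if k is k'.+1 then gain t' k' * weight t' k' else 0)
  else k == 0.

Lemma weightS t k :
  weight t.+1 k = (d t - gain t k) * weight t k +
                  (if k is k'.+1 then gain t k' * weight t k' else 0).
Proof. by []. Qed.

Definition denom (t : nat) : nat := \prod_(s < t) d s.

Lemma denomS t : denom t.+1 = denom t * d t.
Proof. exact: big_ord_recr. Qed.

Lemma weight_eq0 t k : t < k -> weight t k = 0.
Proof.
elim: t k => [|t IH] [|k] // tk; rewrite weightS.
by rewrite !IH // ?muln0 // ltnW.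
Qed.

Variable n : nat.
Hypothesis a_le : forall s, s < n -> a s <= d s.
Hypothesis d_gt0 : forall s, s < n -> 0 < d s.

Lemma gain_le t k : t < n -> gain t k <= d t.
Proof. by move=> /a_le; rewrite /gain; case: ifP => // _; case: ifP. Qed.

(** Mass is conserved: [weight t k] is passed on to k with factor [d t - gain t k] and to k + 1 with
    factor [gain t k], in total [d t] times. *)
Lemma sum_weight t : t <= n -> \sum_(k < t.+1) weight t k = denom t.
Proof.
elim: t => [|t IH] tn; first by rewrite big_ord1 /denom big_ord0.
rewrite denomS -IH 1?ltnW //; under eq_bigr do rewrite weightS.
rewrite big_split big_ord_recr weight_eq0 //=.
rewrite muln0 addn0 [X in _ + X]big_ord_recl add0n -big_split /= big_distrl /=.
apply: eq_bigr => k _; rewrite -mulnDl subnK 1?mulnC //; exact: gain_le.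
Qed.

Lemma weight_le t k : t <= n -> weight t k <= denom t.
Proof.
move=> tn; have [kt|/weight_eq0 -> //] := leqP k t.
have lt : k < t.+1 by [].
by rewrite -sum_weight // (bigD1 (Ordinal lt)) //= leq_addr.
Qed.

Lemma denom_le t : t <= n -> denom t <= denom n.
Proof.
elim: n d_gt0 => [|m IH] dm; first by case: t.
rewrite leq_eqVlt => /predU1P[-> //|tm]; rewrite denomS.
by apply: leq_trans (IH _ tm) _; [move=> s /ltnW; apply: dm | rewrite leq_pmulr ?dm].
Qed.

End Weights.

(* Registers: 0 = n, 1 = the constant 1, 2 = input pointer and then address of
   the weight of 0, 3 = reading counter, 4 = last data item read, 5 = t (and the
   summation index at the end), 6 = n - t, 7 = current area or an address,
   8, 9, 10 = c, numerator, denominator of the current area, 11 = common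
   denominator, 12 = k, 13 ... 19 = temporaries; the data start at cell 20 and
   the weights follow them. *)
Definition load_init : seq instr :=
  [:: Const 1 1; Const 2 20; Const 3 3; Mul 3 3 0].
Definition load_store : seq instr := [:: Store 2 4].
Definition load_next : seq instr := [:: Add 2 2 1; Defs.Sub 3 3 1].
(** Register 5 is still 0, so the addition copies n. The store writes [weight 0 0], which is 1; the
    other weight cells are 0 from the start. *)
Definition time_init : seq instr :=
  [:: Const 11 1; Add 6 0 5; Store 2 1].
(** Area v occupies the three cells from 20 + 3v on. Register 12 starts at t + 1, one above the
    largest k, because [weight_gain] decrements it first. *)
Definition area_fetch : seq instr :=
  [:: Const 8 3; Mul 7 8 7; Const 8 20; Add 7 8 7; Fetch 8 7; Add 7 7 1;
      Fetch 9 7; Add 7 7 1; Fetch 10 7; Mul 11 11 10; Add 12 5 1].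
(* [1 - (t + c - 2k)] and [1 - (2k + c - t)] are the truth values of the two
   forcing conditions; they are not both 1 because [c > 0]. *)
Definition weight_gain : seq instr :=
  [:: Defs.Sub 12 12 1; Add 13 12 12; Add 14 5 8; Defs.Sub 14 14 13;
      Defs.Sub 14 1 14; Add 15 13 8; Defs.Sub 15 15 5; Defs.Sub 15 1 15;
      Add 15 14 15; Defs.Sub 15 1 15; Mul 14 14 10; Mul 15 15 9; Add 14 14 15;
      Defs.Sub 15 10 14; Add 16 2 12; Add 17 16 1].
Definition weight_values : seq instr :=
  [:: Fetch 18 16; Fetch 19 17; Mul 14 14 18; Add 19 19 14; Mul 15 15 18].
Definition weight_store : seq instr := [:: Store 17 19; Store 16 15].
Definition time_next : seq instr := [:: Add 5 5 1; Defs.Sub 6 6 1].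
Definition mean_init : seq instr := [:: Const 13 0].
Definition mean_step : seq instr :=
  [:: Add 16 2 5; Fetch 18 16; Mul 18 18 5; Add 13 13 18; Defs.Sub 5 5 1].

(* The numbers are the addresses of the instructions that follow them. *)
Definition prog : program :=
  Read 0 :: load_init ++ JumpPos 1 10 ::
  (* 6 *) Read 4 :: load_store ++ load_next ++ JumpPos 3 6 ::
  (* 11 *) time_init ++ JumpPos 1 54 ::
  (* 15 *) Read 7 :: area_fetch ++ JumpPos 1 51 ::
  (* 28 *) weight_gain ++ weight_values ++ weight_store ++ JumpPos 12 28 ::
  (* 52 *) time_next ++ JumpPos 6 15 ::
  (* 55 *) mean_init ++ JumpPos 1 62 ::
  (* 57 *) mean_step ++ JumpPos 5 57 ::
  (* 63 *) [:: Write 13; Write 11; Halt].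

Definition register_target (a : instr) : bool :=
  match a with
  | Const i _ | Add i _ _ | Defs.Sub i _ _ | Mul i _ _ | Fetch i _ => i < 20
  | _ => false
  end.

Lemma eqn_cell r i : r < 20 -> eqn (20 + i) r = false.
Proof. by move=> r20; apply/eqP; lia. Qed.

Lemma updn_cell m i x r : r < 20 -> updn m (20 + i) x r = m r.
Proof. by move=> r20; rewrite /updn; case: eqnP => // E; lia. Qed.

Lemma run_block_cell b m i :
  all register_target b -> run_block b m (20 + i) = m (20 + i).
Proof.
elim: b m => [|a b IH] m //= /andP[ra rb]; rewrite IH // /updn.
by case: a ra => //= *; rewrite eqn_cell.
Qed.

(** * Correctness and running time of the program *)

Section Run.
Variables (n L Z : nat) (dat sch : seq nat).
Local Notation M := (2 ^ L).
Local Notation dat_at v j := (nth 0 dat (3 * v + j)).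
Let c t := dat_at (nth 0 sch t) 0.
Let a t := dat_at (nth 0 sch t) 1.
Let d t := dat_at (nth 0 sch t) 2.

Hypothesis size_dat : size dat = 3 * n.
Hypothesis size_sch : size sch = n.
Hypothesis sch_lt : all (fun v => v < n) sch.
Hypothesis dat_lt : all (fun x => x < Z) dat.
Hypothesis c_gt0 : forall t, t < n -> 0 < c t.
Hypothesis a_le : forall t, t < n -> a t <= d t.
Hypothesis d_gt0 : forall t, t < n -> 0 < d t.
Hypothesis n_lt : n < Z.
Hypothesis denom_lt : denom d n < Z.
Hypothesis M_ge : 1024 * (Z * Z) <= M.

Local Notation W := (weight c a d).
Local Notation D := (denom d).
Local Notation steps := (reaches prog L).
Local Notation wt i := (20 + (3 * n + i)).

(** The square in [M_ge] serves the final sum, a product of n and a denominator in size; addresses,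
    constants and all other values fit below this linear bound. *)
Lemma M_geZ : 1024 * Z <= M.
Proof. by apply: leq_trans M_ge; nia. Qed.

Lemma prog_const : all (fun a => all (fun k => k < M) (constants a)) prog.
Proof.
have M128 : 128 <= M by have := M_geZ; lia.
have : all (fun a => all (fun k => k < 128) (constants a)) prog by [].
by apply: sub_all => x; apply: sub_all => k kl; apply: leq_trans M128.
Qed.

Lemma L_gt0 : 0 < L.
Proof. by case: L M_geZ => //; rewrite expn0; lia. Qed.

Lemma nth_dat_lt i : nth 0 dat i < Z.
Proof.
have [idat|/(nth_default 0) -> //] := ltnP i (size dat); last by lia.
exact/(allP dat_lt)/mem_nth.
Qed.

Lemma weight_lt t k : t <= n -> W t k < Z.
Proof.
move=> tn; apply: leq_ltn_trans denom_lt.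
exact: leq_trans (weight_le c a_le k tn) (denom_le d_gt0 tn).
Qed.

(* The weights are updated in place in decreasing order of k: the cells above j
   are final, and cell j still lacks the contribution of [k = j - 1]. *)
Definition cell_inv (t j : nat) (m : nat -> nat) : Prop :=
  forall i, m (wt i) =
    if i < j then W t i
    else if i == j then (d t - gain c a d t j) * W t j else W t.+1 i.

Definition weight_inv (t j : nat) (m : nat -> nat) : Prop :=
  [/\ [/\ m 1 = 1, m 2 = wt 0, m 5 = t & m 6 = n - t],
      [/\ m 8 = c t, m 9 = a t, m 10 = d t, m 11 = D t.+1 & m 12 = j],
      forall i, i < 3 * n -> m (20 + i) = nth 0 dat i,
      cell_inv t j m & bounded_mem L m].

(** The left side is the arithmetic of [weight_gain], where 1 - (x - y) is the truth value of x <=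
    y. *)
Lemma gainE t k : t < n ->
  (1 - (t + c t - (k + k))) * d t +
  (1 - ((1 - (t + c t - (k + k))) + (1 - (k + k + c t - t)))) * a t
  = gain c a d t k.
Proof.
move=> /c_gt0 c0; rewrite /gain mul2n -addnn; case: ifP => H1.
  have -> : t + c t - (k + k) = 0 by lia.
  by rewrite subn0 mul1n subnDA subnn sub0n addn0.
have -> : 1 - (t + c t - (k + k)) = 0 by lia.
case: ifP => H2; first by have -> : k + k + c t - t = 0 by lia.
have -> : 1 - (k + k + c t - t) = 0 by lia.
by rewrite mul0n mul1n.
Qed.

Lemma block_run l b m u o :
  take (size b) (drop l prog) = b -> all straight b ->
  bounded_mem L m -> all (fun x => x < M) u ->
  all (fun x => x < M) (block_values b m) ->
  steps (size b) (State l m u o) (State (l + size b) (run_block b m) u o) /\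
  bounded_mem L (run_block b m).
Proof. exact: (reaches_block L_gt0 prog_const). Qed.

Lemma weight_body t j u o m :
  t < n -> j <= t -> all (fun x => x < M) u -> weight_inv t j.+1 m ->
  exists m', steps 23 (State 28 m u o) (State 51 m' u o) /\ weight_inv t j m'.
Proof.
move=> tn jt Hu [[m1 m2 m5 m6] [m8 m9 m10 m11 m12] md mw Bm].
have MZ := M_geZ.
have [ct dt] : c t < Z /\ d t < Z by split; apply: nth_dat_lt.
have ad := a_le tn.
have gd := gain_le c a_le j tn.
have [|R1 B1] := @block_run 28 weight_gain m u o erefl erefl Bm Hu.
  rewrite /weight_gain; eval_block.
  rewrite m1 m2 m5 m8 m9 m10 m12 subn1 /= gainE //.
  set b1 := 1 - (t + _ - _); set b2 := 1 - (j + j + _ - _).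
  have b1d : b1 * d t <= d t by rewrite -[X in _ <= X]mul1n leq_mul // leq_subr.
  have b2a : (1 - (b1 + b2)) * a t <= a t.
    by rewrite -[X in _ <= X]mul1n leq_mul // leq_subr.
  repeat (apply/andP; split => //); lia.
have [[p1 p2 p5 p6 p8] [p9 p10 p11 p12] [p14 p15 p16 p17]] :
    let m' := run_block weight_gain m in
    [/\ [/\ m' 1 = 1, m' 2 = wt 0, m' 5 = t, m' 6 = n - t & m' 8 = c t],
        [/\ m' 9 = a t, m' 10 = d t, m' 11 = D t.+1 & m' 12 = j] &
        [/\ m' 14 = gain c a d t j, m' 15 = d t - gain c a d t j,
            m' 16 = wt j & m' 17 = wt j.+1]].
  rewrite /weight_gain; eval_block.
  by rewrite m1 m2 m5 m6 m8 m9 m10 m11 m12 subn1 /= gainE //; split=> //; split=> //; lia.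
(* The memory becomes abstract: only the register values and the unchanged cells are carried into
   the next block. *)
move: (run_block weight_gain m) R1 B1 p1 p2 p5 p6 p8 p9 p10 p11 p12 p14 p15 p16 p17
  (fun i => @run_block_cell weight_gain m i isT).
move=> {}m1 R1 B1 p1 p2 p5 p6 p8 p9 p10 p11 p12 p14 p15 p16 p17 cell1.
set g := gain c a d t j in gd p14 p15.
(* Every product formed below is a summand of some [W t.+1 k], and so is bounded through
   [weight_lt]. *)
have wj : m1 (wt j) = W t j by rewrite cell1 mw ltnSn.
have wj1 : m1 (wt j.+1) = (d t - gain c a d t j.+1) * W t j.+1.
  by rewrite cell1 mw ltnn eqxx.
have Wj := weight_lt j (ltnW tn); have Wj1 := weight_lt j.+1 tn.
have gW : g * W t j <= W t.+1 j.+1 by rewrite weightS leq_addl.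
have dW : (d t - g) * W t j <= W t.+1 j by rewrite weightS leq_addr.
have W1j := weight_lt j tn.
have eqW : (d t - gain c a d t j.+1) * W t j.+1 + g * W t j = W t.+1 j.+1 by [].
have [|R2 B2] := @block_run 44 weight_values m1 u o erefl erefl B1 Hu.
  rewrite /weight_values; eval_block.
  rewrite p16 p17 !eqn_cell // wj wj1 p14 p15 eqW.
  have eW : (d t - gain c a d t j.+1) * W t j.+1 <= W t.+1 j.+1.
    by rewrite weightS leq_addr.
  repeat (apply/andP; split => //); lia.
have [[q1 q2 q5 q6 q8] [q9 q10 q11 q12] [q15 q16 q17 q19]] :
    let m' := run_block weight_values m1 in
    [/\ [/\ m' 1 = 1, m' 2 = wt 0, m' 5 = t, m' 6 = n - t & m' 8 = c t],
        [/\ m' 9 = a t, m' 10 = d t, m' 11 = D t.+1 & m' 12 = j] &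
        [/\ m' 15 = (d t - g) * W t j, m' 16 = wt j, m' 17 = wt j.+1 &
            m' 19 = W t.+1 j.+1]].
  rewrite /weight_values; eval_block.
  by rewrite p16 p17 !eqn_cell // wj wj1 p14 p15 eqW.
move: (run_block weight_values m1) R2 B2 q1 q2 q5 q6 q8 q9 q10 q11 q12 q15 q16 q17 q19
  (fun i => @run_block_cell weight_values m1 i isT).
move=> mB R2 B2 q1 q2 q5 q6 q8 q9 q10 q11 q12 q15 q16 q17 q19 cell2.
have st2 i : run_block weight_store mB i =
    if i == wt j then (d t - g) * W t j
    else if i == wt j.+1 then W t.+1 j.+1 else mB i.
  by rewrite /= q17 !updn_cell // q16 q15 /updn q19.
have [|R3 B3] := @block_run 49 weight_store mB u o erefl erefl B2 Hu.
  by rewrite /= q17 !updn_cell // !B2.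
exists (run_block weight_store mB); split.
  exact: reaches_trans R1 (reaches_trans R2 R3).
split=> //.
- by rewrite !st2 q1 q2 q5 q6.
- by rewrite !st2 q8 q9 q10 q11 q12.
- move=> i i3; rewrite st2 !ifN_eq ?cell2 ?cell1 ?md //; lia.
move=> i; rewrite st2 !eqn_add2l cell2 cell1 mw ltnS.
case: (ltngtP i j) => [ij|ij|_ //].
  by rewrite ltn_eqF // ltnW.
by case: (ltngtP i j.+1) => [ij1|//|->//]; lia.
Qed.

(** Here j counts the areas still to come, whose part of the schedule is what remains on the input
    tape. *)
Definition time_inv (j : nat) (m : nat -> nat) (u : seq nat) : Prop :=
  exists2 t, t + j = n &
  [/\ bounded_mem L m /\ u = drop t sch,
      [/\ m 1 = 1, m 2 = wt 0, m 5 = t, m 6 = j & m 11 = D t],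
      forall i, i < 3 * n -> m (20 + i) = nth 0 dat i &
      forall i, m (wt i) = W t i].

Lemma input_ltM i : all (fun x => x < M) (drop i dat ++ sch).
Proof.
have MZ := M_geZ; rewrite all_cat; apply/andP; split.
  have : all (fun x => x < M) dat by apply: sub_all dat_lt => x; lia.
  by rewrite -{1}(cat_take_drop i dat) all_cat => /andP[].
by apply: sub_all sch_lt => x; lia.
Qed.

Lemma sch_ltM t : all (fun x => x < M) (drop t sch).
Proof.
have : all (fun x => x < M) sch by have := input_ltM 0; rewrite all_cat => /andP[].
by rewrite -{1}(cat_take_drop t sch) all_cat => /andP[].
Qed.

Lemma time_body j u o m : time_inv j.+1 m u ->
  exists m' u', steps (24 * n + 16) (State 15 m u o) (State 54 m' u' o) /\
                time_inv j m' u'.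
Proof.
move=> [t tj [[Bm ->] [m1 m2 m5 m6 m11] md mw]].
have MZ := M_geZ.
have tn : t < n by lia.
have dropE : drop t sch = nth 0 sch t :: drop t.+1 sch by rewrite -drop_nth ?size_sch.
have vn : nth 0 sch t < n by apply: (all_nthP 0 sch_lt); rewrite size_sch.
have Hu := sch_ltM t; have Hu1 := sch_ltM t.+1; rewrite dropE in Hu *.
have [R0 B0] := reaches_read L_gt0 prog_const o
  (erefl : onth prog 15 = Some (Read 7)) Bm Hu.
have [h1 h2 h5 h6 h11] : let m' := upd m 7 (nth 0 sch t) in
  [/\ m' 1 = 1, m' 2 = wt 0, m' 5 = t, m' 6 = j.+1 & m' 11 = D t] by [].
have h7 : upd m 7 (nth 0 sch t) 7 = nth 0 sch t by [].
have hcell i : upd m 7 (nth 0 sch t) (20 + i) = m (20 + i) by rewrite /upd -eqnE eqn_cell.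
move: (upd _ _ _) R0 B0 h1 h2 h5 h6 h7 h11 hcell => mA R0 B0 h1 h2 h5 h6 h7 h11 hcell.
have c_t : mA (20 + 3 * nth 0 sch t) = c t by rewrite hcell md /c ?addn0 //; lia.
have a_t : mA (20 + (3 * nth 0 sch t + 1)) = a t by rewrite hcell md //; lia.
have d_t : mA (20 + (3 * nth 0 sch t + 2)) = d t by rewrite hcell md //; lia.
have [ct dt] : c t < Z /\ d t < Z by split; apply: nth_dat_lt.
have atz := a_le tn.
have Dt : D t.+1 < Z by apply: leq_ltn_trans denom_lt; exact: (denom_le d_gt0).
have Dt' : D t.+1 = D t * d t by apply: denomS.
have x3 : 3 * nth 0 sch t + 2 < 3 * n by lia.
move xE: (3 * nth 0 sch t) c_t a_t d_t x3 => x c_t a_t d_t x3.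
have [|R1 B1] := @block_run 16 area_fetch mA (drop t.+1 sch) o erefl erefl B0 Hu1.
  rewrite /area_fetch; eval_block.
  rewrite h1 h5 h7 xE h11 -!addnA !eqn_cell // c_t a_t d_t -Dt'.
  repeat (apply/andP; split => //); lia.
have [[p1 p2 p5 p6] [p8 p9 p10 p11 p12]] :
    let m' := run_block area_fetch mA in
    [/\ m' 1 = 1, m' 2 = wt 0, m' 5 = t & m' 6 = n - t] /\
    [/\ m' 8 = c t, m' 9 = a t, m' 10 = d t, m' 11 = D t.+1 & m' 12 = t.+1].
  rewrite /area_fetch; eval_block.
  rewrite h1 h2 h5 h6 h7 xE h11 -!addnA !eqn_cell // c_t a_t d_t -Dt' addn1.
  by split=> //; split=> //; lia.
move: (run_block area_fetch mA) R1 B1 p1 p2 p5 p6 p8 p9 p10 p11 p12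
  (fun i => @run_block_cell area_fetch mA i isT).
move=> mB R1 B1 p1 p2 p5 p6 p8 p9 p10 p11 p12 cellB.
have := reaches_jump L_gt0 prog_const o
  (erefl : onth prog 27 = Some (JumpPos 1 51)) B1 Hu1.
rewrite p1 /= => R2.
pose Inv k m' u' := [/\ k <= t.+1, weight_inv t k m' & u' = drop t.+1 sch].
have [|||mC [uC [R3 [_ [[q1 q2 q5 q6] [_ _ _ q11 _] qd qw BC] uE]]]] :=
  @reaches_loop prog L L_gt0 prog_const 51 12 28 23 o Inv
    erefl _ _ t.+1 mB (drop t.+1 sch).
- by move=> k m' u' [_ [_ [_ _ _ _ ? _ _ ?]] ->].
- move=> k m' u' [kt I ->]; have [mD [RD ID]] := weight_body o tn kt Hu1 I.
  by exists mD, (drop t.+1 sch); split=> //; split=> //; apply: ltnW.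
- split=> //; split=> //; first by move=> i i3; rewrite cellB hcell md.
  (* At the start the cells above t contain 0, as the invariant at t + 1 requires: the weights
     involved vanish by [weight_eq0]. *)
  move=> i; rewrite cellB hcell mw.
  case: (ltngtP i t.+1) => [//|it|->]; first by rewrite !weight_eq0 // ltnW.
  by rewrite weight_eq0 ?muln0.
subst uC.
have [|R4 B4] := @block_run 52 time_next mC (drop t.+1 sch) o erefl erefl BC Hu1.
  rewrite /time_next; eval_block; rewrite q1 q5 q6; repeat (apply/andP; split=> //); lia.
exists (run_block time_next mC), (drop t.+1 sch).
split.
  (* One read, 11 instructions to fetch, one jump, t + 1 rounds of 24 steps with a failing test, and
     2 updates; t + 1 is at most n. *)
  apply: reaches_weaken (reaches_trans R0 (reaches_trans R1 (reaches_trans R2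
    (reaches_trans R3 R4)))).
  have : t.+1 * 24 <= n * 24 by rewrite leq_mul2r.
  rewrite /=; lia.
exists t.+1; first by lia.
split=> //.
- rewrite /time_next; eval_block; rewrite q1 q2 q5 q6 q11.
  by split=> //; lia.
(* Cell 0 lacks nothing after the last round, since no acceptance leads to k = 0. *)
- move=> i; rewrite run_block_cell // qw; case: i => [|i] //.
  by rewrite eqxx weightS addn0.
Qed.
(** The zeros beyond i are recorded because the weight cells must be 0 when tabulation begins. *)
Definition load_inv (j : nat) (m : nat -> nat) (u : seq nat) : Prop :=
  exists2 i, i + j = 3 * n &
  [/\ bounded_mem L m /\ u = drop i dat ++ sch,
      [/\ m 0 = n, m 1 = 1, m 2 = 20 + i, m 3 = j & m 5 = 0] &
      forall k, m (20 + k) = if k < i then nth 0 dat k else 0].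

Lemma load_body j u o m : load_inv j.+1 m u ->
  exists m' u', steps 4 (State 6 m u o) (State 10 m' u' o) /\ load_inv j m' u'.
Proof.
move=> [i ij [[Bm ->] [m0 m1 m2 m3 m5] mk]].
have MZ := M_geZ.
have dropE : drop i dat = nth 0 dat i :: drop i.+1 dat.
  by rewrite -drop_nth ?size_dat //; lia.
have Hu := input_ltM i; have Hu1 := input_ltM i.+1; rewrite dropE /= in Hu *.
have [R0 B0] := reaches_read L_gt0 prog_const o
  (erefl : onth prog 6 = Some (Read 4)) Bm Hu.
have [[h0 h1 h2 h3 h5] h4] : let m' := upd m 4 (nth 0 dat i) in
  [/\ m' 0 = n, m' 1 = 1, m' 2 = 20 + i, m' 3 = j.+1 & m' 5 = 0] /\
  m' 4 = nth 0 dat i by [].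
have hcell k : upd m 4 (nth 0 dat i) (20 + k) = m (20 + k).
  by rewrite /upd -eqnE eqn_cell.
move: (upd _ _ _) R0 B0 h0 h1 h2 h3 h4 h5 hcell => mA R0 B0 h0 h1 h2 h3 h4 h5 hcell.
have [|R1 B1] := @block_run 7 load_store mA (drop i.+1 dat ++ sch) o erefl erefl B0 Hu1.
  by rewrite /= B0.
have [[p0 p1 p2 p3 p5] cellB] : let m' := run_block load_store mA in
    [/\ m' 0 = n, m' 1 = 1, m' 2 = 20 + i, m' 3 = j.+1 & m' 5 = 0] /\
    forall k, m' (20 + k) = if k == i then nth 0 dat i else m (20 + k).
  rewrite /= h2 !updn_cell // h4; split=> // k.
  by rewrite /updn eqnE eqn_add2l hcell.
move: (run_block load_store mA) R1 B1 p0 p1 p2 p3 p5 cellB.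
move=> mB R1 B1 p0 p1 p2 p3 p5 cellB.
have [|R2 B2] := @block_run 8 load_next mB (drop i.+1 dat ++ sch) o erefl erefl B1 Hu1.
  rewrite /load_next; eval_block; rewrite p1 p2 p3; repeat (apply/andP; split=> //); lia.
exists (run_block load_next mB), (drop i.+1 dat ++ sch); split.
  exact: reaches_trans R0 (reaches_trans R1 R2).
exists i.+1; first by lia.
split=> //.
  by rewrite /load_next; eval_block; rewrite p0 p1 p2 p3 p5; split=> //; lia.
move=> k; rewrite run_block_cell // cellB mk.
by case: (ltngtP k i) => [ki|ki|->]; rewrite ?ltnSn // ltnS leqNgt;
  [rewrite ltnNge ltnW|rewrite ki].
Qed.

Definition mean_part (j : nat) : nat := \sum_(j.+1 <= k < n.+1) k * W n k.

(** Each factor k is at most n, and the weights sum to [D n]. *)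
Lemma mean_part_le j : mean_part j <= n * D n.
Proof.
rewrite -(sum_weight c a_le (leqnn n)) big_distrr /=.
rewrite -(big_mkord xpredT (fun k => n * W n k)).
rewrite /mean_part; have [jn|jn] := leqP j.+1 n.+1; last by rewrite big_geq // ltnW.
rewrite [leqRHS](big_cat_nat (n := j.+1)) //=; apply: leq_trans (leq_addl _ _).
rewrite big_nat [X in _ <= X]big_nat; apply: leq_sum => k /andP[_ kn].
by rewrite leq_mul2r -ltnS kn orbT.
Qed.

Definition mean_inv (j : nat) (m : nat -> nat) (u : seq nat) : Prop :=
  [/\ bounded_mem L m /\ u = [::], j <= n,
      [/\ m 1 = 1, m 2 = wt 0, m 5 = j, m 11 = D n & m 13 = mean_part j] &
      forall i, m (wt i) = W n i].

Lemma mean_body j u o m : mean_inv j.+1 m u ->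
  exists m' u', steps 5 (State 57 m u o) (State 62 m' u' o) /\ mean_inv j m' u'.
Proof.
move=> [[Bm ->] jn [m1 m2 m5 m11 m13] mw].
have MZ := M_geZ.
have wE : wt 0 + j.+1 = wt j.+1 by lia.
have pE : mean_part j.+1 + W n j.+1 * j.+1 = mean_part j.
  by rewrite /mean_part [in RHS]big_ltn // addnC [W _ _ * _]mulnC.
have ple : mean_part j < Z * Z.
  by apply: leq_ltn_trans (mean_part_le j) _; apply: ltn_mul.
have Wle : W n j.+1 * j.+1 <= mean_part j by rewrite -pE leq_addl.
have [|R B] := @block_run 57 mean_step m [::] o erefl erefl Bm isT.
  rewrite /mean_step; eval_block; rewrite m1 m2 m5 m13 wE eqn_cell // mw pE.
  have := weight_lt j.+1 (leqnn n).
  repeat (apply/andP; split => //); lia.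
exists (run_block mean_step m), [::]; split=> //; split=> //.
- exact: ltnW.
- by rewrite /mean_step; eval_block; rewrite m1 m2 m5 m11 m13 wE eqn_cell // mw pE subn1.
Qed.

Lemma prog_correct : exists2 t,
  halts prog (initial (n :: dat ++ sch)) [:: \sum_(k < n.+1) k * W n k; D n] t &
  t <= 200 * n.+1 ^ 2 * L.
Proof.
have MZ := M_geZ.
have Hu := input_ltM 0; rewrite drop0 in Hu.
have Hn : all (fun x => x < M) (n :: dat ++ sch) by rewrite /= Hu andbT; lia.
have B0 : bounded_mem L (fun=> 0) by move=> i; lia.
have [R1 B1] := reaches_read L_gt0 prog_const [::]
  (erefl : onth prog 0 = Some (Read 0)) B0 Hn.
move mA: (upd _ _ _) R1 B1 => m1 R1 B1.
have [|R2 B2] := @block_run 1 load_init m1 (dat ++ sch) [::] erefl erefl B1 Hu.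
  rewrite /load_init; eval_block; rewrite -mA.
  repeat (apply/andP; split => //); rewrite /upd /=; lia.
have I2 : load_inv (3 * n) (run_block load_init m1) (dat ++ sch).
  exists 0 => //; split; [by rewrite drop0 | | by move=> k; rewrite run_block_cell // -mA].
  by rewrite /load_init; eval_block; rewrite -mA.
move: (run_block load_init m1) R2 B2 I2 => m2 R2 B2 I2.
(* Register 1 contains 1, so the jump is always taken; it enters the loop at its test. *)
have R3 := reaches_jump L_gt0 prog_const [::]
  (erefl : onth prog 5 = Some (JumpPos 1 10)) B2 Hu.
have [i2 _ [_ [_ m21 _ _ _] _]] := I2; rewrite m21 /= in R3.
have [||m3 [u3 [R4 I3]]] :=
  @reaches_loop prog L L_gt0 prog_const 10 3 6 4 [::] load_inv erefl _ _ _ _ _ I2.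
- by move=> j m u [i _ [[? ->] [_ _ _ ? _] _]]; split=> //; apply: input_ltM.
- by move=> j m u; apply: load_body.
have {I3} [i iE [[B3 uE] [m30 m31 m32 _ m35] m3k]] := I3; subst u3.
rewrite addn0 in iE; subst i; rewrite -size_dat drop_size /= in R4.
have Hs := sch_ltM 0; rewrite drop0 in Hs.
have [|R5 B5] := @block_run 11 time_init m3 sch [::] erefl erefl B3 Hs.
  rewrite /time_init; eval_block; rewrite m31 m30 m35 addn0; lia.
have I5 : time_inv n (run_block time_init m3) sch.
  (* The store is split off, as its target is the first weight cell and not a register. *)
  have E5 : run_block time_init m3 =
    updn (run_block [:: Const 11 1; Add 6 0 5] m3) (m3 2) (m3 1) by [].
  exists 0 => //; rewrite drop0; split=> //; rewrite E5 m32 m31.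
  - rewrite !updn_cell // addn0 /denom big_ord0; eval_block.
    by rewrite m30 m31 m32 m35 addn0.
  - move=> k k3; rewrite /updn eqnE eqn_add2l ltn_eqF //.
    by rewrite run_block_cell // m3k k3.
  move=> k; rewrite /updn eqnE eqn_add2l -[in X in _ == X](addn0 (3 * n)) eqn_add2l.
  by rewrite run_block_cell // m3k ltnNge leq_addr; case: k.
move: (run_block time_init m3) R5 B5 I5 => m5 R5 B5 I5.
have R6 := reaches_jump L_gt0 prog_const [::]
  (erefl : onth prog 14 = Some (JumpPos 1 54)) B5 Hs.
have [i5 _ [_ [m51 _ _ _ _] _ _]] := I5; rewrite m51 /= in R6.
have [||m7 [u7 [R7 I7]]] :=
  @reaches_loop prog L L_gt0 prog_const 54 6 15 (24 * n + 16) [::] time_inv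
    erefl _ _ _ _ _ I5.
- by move=> j m u [i _ [[? ->] [_ _ _ ? _] _ _]]; split=> //; apply: sch_ltM.
- by move=> j m u; apply: time_body.
have {I7} [i iE [[B7 uE] [m71 m72 m75 _ m7D] _ m7k]] := I7; subst u7.
rewrite addn0 in iE; rewrite {i}iE in m75 m7D m7k R7 *.
rewrite drop_oversize ?size_sch // in R7.
have [|R8 B8] := @block_run 55 mean_init m7 [::] [::] erefl erefl B7 isT.
  by rewrite /=; lia.
(* The time loop has left n in register 5, which now becomes the descending summation index; the
   partial sum is empty at n. *)
have I8 : mean_inv n (run_block mean_init m7) [::].
  split=> //.
  by rewrite /mean_init; eval_block; rewrite m71 m72 m75 m7D /mean_part big_geq.
move: (run_block mean_init m7) R8 B8 I8 => m8 R8 B8 I8.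
have Hnil : all (fun x => x < M) [::] by [].
have R9 := reaches_jump L_gt0 prog_const [::]
  (erefl : onth prog 56 = Some (JumpPos 1 62)) B8 Hnil.
have [_ _ [m81 _ _ _ _] _] := I8; rewrite m81 /= in R9.
have [||m9 [u9 [R10 I9]]] :=
  @reaches_loop prog L L_gt0 prog_const 62 5 57 5 [::] mean_inv erefl _ _ _ _ _ I8.
- by move=> j m u [[? ->] _ [_ _ ? _ _] _]; split.
- by move=> j m u; apply: mean_body.
have {I9} [[B9 uE] _ [_ _ _ m9D m9S] _] := I9; subst u9.
have R11 := reaches_write L_gt0 prog_const [::]
  (erefl : onth prog 63 = Some (Write 13)) B9 Hnil.
have R12 := reaches_write L_gt0 prog_const (rcons [::] (m9 13))
  (erefl : onth prog 64 = Some (Write 11)) B9 Hnil.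
have R := reaches_trans R1 (reaches_trans R2 (reaches_trans R3 (reaches_trans R4
  (reaches_trans R5 (reaches_trans R6 (reaches_trans R7 (reaches_trans R8
  (reaches_trans R9 (reaches_trans R10 (reaches_trans R11 R12)))))))))).
have [//|t Ht tle] := halts_reaches L_gt0 _ R.
exists t.
  suff -> : \sum_(k < n.+1) k * W n k = mean_part 0 by rewrite -m9D -m9S.
  by rewrite -(big_mkord xpredT (fun k => k * W n k)) big_ltn.
(* There are at most 40 (n + 1)^2 steps, [Halt] included, and each costs at most 5L. *)
apply: leq_trans tle _; rewrite mulnA leq_mul2r; apply/orP; right.
rewrite size_dat /= expnS expn1; nia.
Qed.

End Run.

(** * The law of the number of adopters *)

Import Order.TTheory GRing.Theory Num.Theory.
Local Open Scope ring_scope.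

Section ChainRule.

Definition count_before n (y : {ffun 'I_n -> bool}) (t : nat) : nat :=
  (\sum_(s < n) ((s < t) && y s))%N.

Definition extend n (p : {ffun 'I_n -> bool} * bool) : {ffun 'I_n.+1 -> bool} :=
  [ffun i => if unlift ord_max i is Some j then p.1 j else p.2].

Lemma extend_widen n p (j : 'I_n) : extend p (widen_ord (leqnSn n) j) = p.1 j.
Proof.
have -> : widen_ord (leqnSn n) j = lift ord_max j.
  by apply: val_inj; rewrite /= /bump leqNgt ltn_ord.
by rewrite ffunE liftK.
Qed.

Lemma extend_max n (p : {ffun 'I_n -> bool} * bool) : extend p ord_max = p.2.
Proof. by rewrite ffunE unlift_none. Qed.

(** This splits a sum over n + 1 decisions into one over the first n and one over the last. *)
Lemma extend_bij n : bijective (@extend n).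
Proof.
exists (fun y : {ffun 'I_n.+1 -> bool} => ([ffun j => y (widen_ord (leqnSn n) j)], y ord_max)).
  case=> y b; congr (_, _); last exact: extend_max.
  by apply/ffunP => j; rewrite ffunE extend_widen.
move=> y; apply/ffunP => i; rewrite ffunE; case: unliftP => [j|] -> //=.
by rewrite ffunE; congr (y _); apply: val_inj; rewrite /= /bump leqNgt ltn_ord.
Qed.

Variables (c a d : nat -> nat) (g : nat -> nat -> bool -> rat).

(** Here [g t k b] is the probability of decision b at time t after k acceptances. The induction on
    n needs every h: summing out the last decision turns h into its conditional expectation, again a
    function of the number of acceptances. *)
Lemma chain_rule n (h : nat -> rat) :
  (forall t k, (t < n)%N ->
     g t k true * (d t)%:R = (gain c a d t k)%:R /\
     g t k false * (d t)%:R = (d t - gain c a d t k)%:R) ->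
  (\sum_(y : {ffun 'I_n -> bool})
     (\prod_(t < n) g t (count_before y t) (y t)) * h (count_before y n)) *
    (denom d n)%:R =
  \sum_(k < n.+1) (weight c a d n k)%:R * h k.
Proof.
elim: n h => [|n IH] h gE.
  rewrite big_ord1 /= mul1r /denom big_ord0 mulr1.
  rewrite (bigD1 [ffun=> false]) //= big_ord0 [X in _ + X]big1 => [|y].
    by rewrite addr0 mul1r /count_before big_ord0.
  by move=> /eqP; case; apply/ffunP => -[].
rewrite (reindex (@extend n)) /=; last exact/onW_bij/extend_bij.
rewrite -(pair_bigA _ (fun y b => (\prod_(t < n.+1)
  g t (count_before (extend (y, b)) t) (extend (y, b) t)) *
  h (count_before (extend (y, b)) n.+1))) /=.
have cntE y b t : count_before (@extend n (y, b)) t = (count_before y t + ((n < t) && b))%N.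
  rewrite /count_before big_ord_recr /= extend_max; congr (_ + _)%N.
  by apply: eq_bigr => j _; rewrite extend_widen.
have cntS y : @count_before n y n.+1 = count_before y n.
  by apply: eq_bigr => j _; rewrite ltnS (ltnW (ltn_ord j)) ltn_ord.
(* The conditional expectation of h given k acceptances before the last decision, scaled by the last
   denominator. *)
pose h' k := (\sum_b g n k b * h (k + b)%N) * (d n)%:R.
rewrite denomS natrM mulrA mulrAC.
transitivity (\sum_(k < n.+1) (weight c a d n k)%:R * h' k).
  rewrite -IH => [|t k tn]; last exact/gE/ltnW.
  congr (_ * _); rewrite big_distrl /=; apply: eq_bigr => y _.
  rewrite /h' mulrA; congr (_ * _); rewrite big_distrr; apply: eq_bigr => b _ /=.
  rewrite big_ord_recr /= extend_max !cntE ltnn ltnSn addn0 cntS mulrA /=.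
  congr (_ * _ * _); apply: eq_bigr => t _.
  by rewrite extend_widen cntE ltnNge (ltnW (ltn_ord t)) addn0.
have h'E k : h' k = (gain c a d n k)%:R * h k.+1 + (d n - gain c a d n k)%:R * h k.
  have [gt gf] := gE n k (ltnSn n).
  by rewrite /h' big_bool /= addn1 addn0 mulrDl -gt -gf; ring.
transitivity (
    \sum_(k < n.+1) (weight c a d n k)%:R * ((d n - gain c a d n k)%:R * h k) +
    \sum_(k < n.+1) (weight c a d n k)%:R * ((gain c a d n k)%:R * h k.+1)).
  by rewrite -big_split; apply: eq_bigr => k _; rewrite h'E mulrDr addrC.
(* The recurrence is split into rejection and acceptance. The first sum has a null term at k = n + 1
   and the second at k = 0, where its index is then shifted. *)
symmetry; transitivity (
    \sum_(k < n.+2) ((d n - gain c a d n k) * weight c a d n k)%N%:R * h k +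
    \sum_(k < n.+2)
      (if k : nat is k'.+1 then gain c a d n k' * weight c a d n k' else 0)%N%:R * h k).
  by rewrite -big_split; apply: eq_bigr => k _; rewrite natrD mulrDl.
congr (_ + _).
  rewrite big_ord_recr /= weight_eq0 // muln0 mul0r addr0.
  by apply: eq_bigr => k _; rewrite natrM; ring.
rewrite [LHS]big_ord_recl mul0r add0r.
by apply: eq_bigr => k _; rewrite /= natrM; ring.
Qed.
End ChainRule.

(** * From instances of the process to the recurrence *)

Section Instance.
Variable I : instance.
Local Notation n := (areas I).
Local Notation pi := (strategy I).

Definition data : seq nat :=
  flatten [seq [:: threshold v; `|numq (prob v)|%N; `|denq (prob v)|%N]
          | v <- enum 'I_n].
Definition schedule : seq nat := [seq val (pi t) | t <- enum 'I_n].
(** The parameters at time t are looked up in the input as the machine does it, so that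
    [prog_correct] applies to them literally. *)
Definition thr (t : nat) : nat := nth 0 data (3 * nth 0 schedule t + 0).
Definition num (t : nat) : nat := nth 0 data (3 * nth 0 schedule t + 1).
Definition den (t : nat) : nat := nth 0 data (3 * nth 0 schedule t + 2).

Lemma size_data : size data = (3 * n)%N.
Proof.
rewrite /data size_flatten /shape -map_comp -[n in RHS]size_enum_ord.
by elim: (enum 'I_n) => //= v s ->; rewrite mulnS.
Qed.

Lemma size_schedule : size schedule = n.
Proof. by rewrite size_map size_enum_ord. Qed.

Lemma nth_flatten_const (T : Type) (f : T -> seq nat) (m : nat) (x0 : T) (s : seq T)
    (i j : nat) :
  (forall x, size (f x) = m) -> (i < size s)%N -> (j < m)%N ->
  nth 0%N (flatten [seq f x | x <- s]) (m * i + j) = nth 0%N (f (nth x0 s i)) j.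
Proof.
move=> fm; elim: s i => //= x s IH [|i] si jm; rewrite nth_cat fm.
  by rewrite muln0 add0n jm.
by rewrite mulnS -(addnA m) ltnNge leq_addr /= addKn; apply: IH.
Qed.

Lemma nth_schedule (t : 'I_n) : nth 0%N schedule t = pi t.
Proof. by rewrite (nth_map t) ?size_enum_ord // nth_ord_enum. Qed.

Lemma nth_data (t : 'I_n) :
  [/\ thr t = threshold (pi t), num t = `|numq (prob (pi t))|%N
    & den t = `|denq (prob (pi t))|%N].
Proof.
have lt : (pi t < size (enum 'I_n))%N by rewrite size_enum_ord.
rewrite /thr /num /den nth_schedule.
pose f (v : 'I_n) := [:: threshold v; `|numq (prob v)|%N; `|denq (prob v)|%N].
have nthE j : (j < 3)%N -> nth 0%N data (3 * pi t + j) = nth 0%N (f (pi t)) j.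
  by move=> j3; rewrite (nth_flatten_const (f := f) t) // nth_ord_enum.
by split; apply: nthE.
Qed.

Lemma num_le_den t : (t < n)%N -> (num t <= den t)%N.
Proof.
move=> tn; have [_ -> ->] := nth_data (Ordinal tn).
have /andP[p0 p1] := prob_01 (pi (Ordinal tn)); move: (prob _) p0 p1 => p p0 p1.
have n0 : 0 <= numq p by rewrite numq_ge0.
have : p * (denq p)%:~R <= 1 * (denq p)%:~R.
  by apply: ler_wpM2r p1; rewrite ler0z denq_ge0.
rewrite mul1r -numqE ler_int; have := denq_gt0 p; lia.
Qed.

Lemma den_gt0 t : (t < n)%N -> (0 < den t)%N.
Proof.
move=> tn; have [_ _ ->] := nth_data (Ordinal tn).
by rewrite absz_gt0 denq_neq0.
Qed.

Lemma thr_gt0 t : (t < n)%N -> (0 < thr t)%N.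
Proof. by move=> tn; have [-> _ _] := nth_data (Ordinal tn); apply: threshold_gt0. Qed.

(** The form that [chain_rule] expects: k acceptances and t - k rejections give influence 2k - t.
    The value 0 is a default for t outside the schedule. *)
Definition step_prob (t k : nat) (b : bool) : rat :=
  if insub t is Some i then
    decision_prob (pi i) ((k + k)%:Z - t%:Z) b
  else 0.

Lemma step_probE t k : (t < n)%N ->
  step_prob t k true * (den t)%:R = (gain thr num den t k)%:R /\
  step_prob t k false * (den t)%:R = (den t - gain thr num den t k)%:R.
Proof.
move=> tn; have gd := gain_le thr num_le_den k tn.
(* Rejection has the complementary probability, so acceptance suffices; [gd] makes the truncated
   subtraction exact. *)
suff E : step_prob t k true * (den t)%:R = (gain thr num den t k)%:R.
  split=> //; rewrite natrB // -E /step_prob.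
  by case: insubP => [i _ _|]; [rewrite /decision_prob; ring | rewrite tn].
rewrite /step_prob insubT /decision_prob /accept_prob /gain.
have [tE nE dE] := nth_data (Ordinal tn); rewrite /= in tE nE dE.
rewrite -[Sub t tn]/(Ordinal tn) -tE.
have -> : ((thr t)%:Z <= (k + k)%:Z - t%:Z) = (t + thr t <= 2 * k)%N by lia.
case: ifP => _; first by rewrite mul1r.
have -> : ((k + k)%:Z - t%:Z <= - (thr t)%:Z) = (2 * k + thr t <= t)%N by lia.
case: ifP => _; first by rewrite mul0r.
rewrite nE dE; have /andP[p0 _] := prob_01 (pi (Ordinal tn)); move: (prob _) p0 => p p0.
by rewrite !natr_absz !ger0_norm ?numq_ge0 ?denq_ge0 // numqE.
Qed.

(** This is [chain_rule] with h the identity, once outcomes are indexed by time instead of by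
    area. *)
Lemma expectationE : expected_adopters I =
  (\sum_(k < n.+1) k * weight thr num den n k)%N%:R / (denom den n)%:R.
Proof.
have D0 : (denom den n)%:R != 0 :> rat.
  rewrite pnatr_eq0 -lt0n prodn_gt0 // => t; exact: den_gt0.
apply: (canRL (mulfK D0)).
have -> : (\sum_(k < n.+1) k * weight thr num den n k)%N%:R =
  \sum_(k < n.+1) (weight thr num den n k)%:R * k%:R :> rat.
  by rewrite natr_sum; apply: eq_bigr => k _; rewrite natrM mulrC.
rewrite -(chain_rule (fun k => k%:R) step_probE); congr (_ * _).
rewrite /expected_adopters.
pose F (y : {ffun 'I_n -> bool}) : outcome I := [ffun v => y (pi^-1%g v)].
have Fpi y t : F y (pi t) = y t by rewrite ffunE permK.
rewrite (reindex F) /=; last first.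
  apply: onW_bij; exists (fun x : outcome I => [ffun t => x (pi t)]) => y.
    by apply/ffunP => t; rewrite ffunE Fpi.
  by apply/ffunP => v; rewrite !ffunE permKV.
apply: eq_bigr => y _; congr (_ * _).
  apply: eq_bigr => t _; rewrite Fpi /step_prob valK; congr decision_prob.
  (* A decision is 2y - 1 with y its truth value; summing over the times before t gives 2k - t. *)
  rewrite /influence (eq_bigr (fun s => (y s + y s)%N%:Z - 1)) => [|s _]; last first.
    by rewrite /decision Fpi; case: (y s).
  rewrite big_split /= -(big_ord_widen n (fun=> -1) (ltnW (ltn_ord t))).
  rewrite sumr_const card_ord mulNrn; congr (_ - _); last exact: natz.
  rewrite -(big_morph _ PoszD (erefl 0%:Z)) big_split /count_before /=.
  by rewrite big_mkcond /=; congr (Posz (_ + _)); apply: eq_bigr => s _; case: ifP.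
congr (_%:R); rewrite /adopters cardsE -sum1_card big_mkcond (reindex_inj (@perm_inj _ pi)).
apply: eq_bigr => t _; rewrite ltn_ord unfold_in /= /decision Fpi.
by case: (y t).
Qed.
End Instance.

(** * Size of the instance *)

Lemma bitlen_le_bitsize (u : seq nat) (x : nat) : x \in u -> (bitlen x <= bitsize u)%N.
Proof. by move=> xu; rewrite /bitsize (big_rem x) //= leq_addr. Qed.

Lemma ltn_exp_bitsize (u : seq nat) (x : nat) : x \in u -> (x < 2 ^ bitsize u)%N.
Proof.
move=> /bitlen_le_bitsize xu; apply: leq_trans (bitlen_ltn x) _.
by rewrite leq_exp2l.
Qed.

Lemma size_le_bitsize (u : seq nat) : (size u <= bitsize u)%N.
Proof. by rewrite /bitsize -sum1_size; apply: leq_sum. Qed.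

(** Each denominator is below 2 to its bit length, and these bit lengths are separate summands of
    the code size. The entry n of the code makes the inequality strict. *)
Lemma denom_lt_bitsize (I : instance) :
  (denom (den I) (areas I) < 2 ^ bitsize (instance_code I))%N.
Proof.
pose B := (\sum_(v < areas I) bitlen `|denq (prob v)|)%N.
have lt : (B < bitsize (instance_code I))%N.
  rewrite /bitsize big_cons -addn1 addnC leq_add // big_cat big_flatten big_map /=.
  apply: leq_trans (leq_addr _ _); rewrite big_enum; apply: leq_sum => v _.
  by rewrite !big_cons big_nil addn0 addnA leq_addl.
apply: (@leq_ltn_trans (2 ^ B)%N); last by rewrite ltn_exp2l.
rewrite /B (reindex_inj (@perm_inj _ (strategy I))) /= expn_sum /denom.
apply: leq_prod => t _; have [_ _ ->] := nth_data t.
exact/ltnW/bitlen_ltn.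
Qed.

Theorem theorem5 :
  poly_time_computable instance_code fraction_code expected_adopters.
Proof.
(* With S the code size and Z = 2^S, the word length L = 2S + 10 gives 2^L = 1024 Z^2. The code has
   more than n entries of at least one bit, so n + 1 <= S. *)
exists prog, (200%N%:P * 'X^2 * (2%N%:P * 'X + 10%N%:P)) => I.
have codeE : instance_code I = areas I :: data I ++ schedule I by [].
have denom_lt := denom_lt_bitsize I.
have := size_le_bitsize (instance_code I); have := @ltn_exp_bitsize (instance_code I).
move: (bitsize _) denom_lt => S denom_lt code_lt n_lt.
have dat_lt : all (fun x => x < 2 ^ S)%N (data I).
  by apply/allP => x xI; apply: code_lt; rewrite codeE inE mem_cat xI orbT.
have sch_lt : all (fun v => v < areas I)%N (schedule I).
  by apply/allP => _ /mapP[t _ ->]; apply: ltn_ord.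
have nS : (areas I < 2 ^ S)%N by apply: code_lt; rewrite codeE inE eqxx.
have ZS : (1024 * (2 ^ S * 2 ^ S) <= 2 ^ (2 * S + 10))%N.
  by rewrite expnD mul2n -addnn expnD mulnC leq_mul2l orbT.
have [t Ht tle] := prog_correct (size_data I) (size_schedule I)
  sch_lt dat_lt (@thr_gt0 I) (@num_le_den I) (@den_gt0 I) nS denom_lt ZS.
exists [:: (\sum_(k < (areas I).+1) k * weight (thr I) (num I) (den I) (areas I) k)%N;
           denom (den I) (areas I)], t.
split=> //.
  exists (\sum_(k < (areas I).+1) k * weight (thr I) (num I) (den I) (areas I) k)%N.
  exists (denom (den I) (areas I)); split=> //; last exact: expectationE.
  by apply: prodn_gt0 => i; apply: den_gt0.
rewrite !hornerE.
have {}n_lt : ((areas I).+1 <= S)%N.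
  by apply: leq_trans n_lt; rewrite codeE /= ltnS size_cat size_schedule leq_addl.
apply: leq_trans tle _.
change (200 * (areas I).+1 ^ 2 * (2 * S + 10) <= 200 * S * S * (2 * S + 10))%N.
by rewrite leq_mul // -mulnA -mulnn leq_mul // leq_mul.
Qed.
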